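(* Let $\mathcal V=\{V;\nu_1,\dots,\nu_n\}$ be a signed vector arrangement over $\Bbbk$. The homology $H_{Kh}^\bullet(\mathcal V)$ categorifies the framed Jones polynomial: $\chi_q(H_{Kh}^\bullet(\mathcal V))=J(\mathcal V)$.
   Context: Let $\Bbbk$ be a field of characteristic zero. A signed vector arrangement $\mathcal V=\{V;\nu_1,\dots,\nu_n\}$ is a finite-dimensional $\Bbbk$-vector space $V$ with an inner product, a list of vectors $\nu_i\in V$ (zero allowed) and a sign for each $\nu_i$, giving a partition $[n]=[n]_+\sqcup[n]_-$. For $S\subseteq[n]$: $H_S=\bigcap_{s\in S}\nu_s^\perp$ ($H_\emptyset=V$), $V_S=\mathrm{span}\{\nu_s\}_{s\in S}$, $W=\{w\in\Bbbk^n:\sum w_i\nu_i=0\}$ with inner product induced from the standard one on $\Bbbk^n$, $W_S=\{w\in W:w_r=0\text{ for }r\notin S\}$, $\widetilde S=(S\cap[n]_+)\cup([n]_-\setminus S)$. The vector $\nu_r^\vee\in W$ is the orthogonal projection of the $r$-th standard basis vector of $\Bbbk^n$ to $W$. Inner products are understood to restrict non-degenerately to all subspaces onto which orthogonal projections are taken. Framed Jones polynomial: $J(\mathcal V)=\sum_{S\subseteq[n]}(-1)^{|S|-n/2}q^{|S|-n/2}(q+q^{-1})^{\dim H_{\widetilde S}+\dim W_{\widetilde S}}\in\mathbb Z[i,q^{1/2},q^{-1/2}]$, with $(-1)^{1/2}=i=\sqrt{-1}$. Complex $\mathcal T(\mathcal V)=\bigoplus_{S\subseteq[n]}T_S$,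 $T_S=\bigwedge^\bullet H_{\widetilde S}\otimes\bigwedge^\bullet W_{\widetilde S}$, with (integer or half-integer) bigrading $\deg(\bigwedge^iH_{\widetilde S}\otimes\bigwedge^jW_{\widetilde S})=(|S|-n/2,\ |S|+\dim H_{\widetilde S}+\dim W_{\widetilde S}-2(i+j)-n/2)$; the first degree is homological, the second is the $q$-degree. For $r\notin S$, $\delta_{S,r}:T_S\to T_{S\cup r}$ is: (1) if $r\in[n]_+$, $\nu_r\notin V_{\widetilde S}$: (map induced by orthogonal projection $H_{\widetilde S}\to H_{\widetilde S\cup r}$) $\otimes$ (inclusion $W_{\widetilde S}\subseteq W_{\widetilde S\cup r}$); (2) if $r\in[n]_+$, $\nu_r\in V_{\widetilde S}$: (projection) $\otimes$ (inclusion into $\bigwedge^\bullet W_{\widetilde S\cup r}$ followed by left wedge with the projection of $\nu_r^\vee$ to $W_{\widetilde S\cup r}$); (3) if $r\in[n]_-$, $\nu_r\in V_{\widetilde S-r}$: (inclusion $H_{\widetilde S}\subseteq H_{\widetilde S-r}$) $\otimes$ (orthogonal projection $W_{\widetilde S}\to W_{\widetilde S-r}$); (4) if $r\in[n]_-$, $\nu_r\notin V_{\widetilde S-r}$: (inclusion into $\bigwedge^\bullet H_{\widetilde S-r}$ followed by left wedge with the projection of $\nu_r$ to $H_{\widetilde S-r}$) $\otimes$ (projection). The differential is $\delta=\bigoplus_{S,\,r\notin S}\epsilon_{S,r}\delta_{S,r}$ for a choice of nonzero scalars $\epsilon_{S,r}\in\Bbbk^\times$ making every square of the cube anticommute (such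 a choice exists, and the homology does not depend on it). $\delta$ has bidegree $(1,0)$. $H_{Kh}^{j,l}(\mathcal V)$ is the homology in homological degree $j$ and $q$-degree $l$. Graded Euler characteristic: $\chi_q(H_{Kh}^\bullet(\mathcal V))=\sum_{j,l\in\frac12\mathbb Z}(-1)^j\dim H_{Kh}^{j,l}(\mathcal V)\,q^l$. *)

(* Defs.v *)
From HB Require Import structures.
From mathcomp Require Import classical_sets fsbigop.
From mathcomp Require Import all_boot all_order all_algebra all_field.
From mathcomp Require Import fraction sesquilinear.

Set Implicit Arguments.
Unset Strict Implicit.
Unset Printing Implicit Defensive.

Import GRing.Theory.
Local Open Scope ring_scope.

(* Exterior algebra of a finite-dimensional space U, in coordinates with
   respect to the basis e_i := (vbasis {:U})`_i: x : ext U is the element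
   \sum_I (x I) e_I, where e_I is the wedge of the e_i (i in I) taken in
   increasing order, so that e_I e_J = (-1)^(inversions I J) e_(I :|: J) if I
   and J are disjoint, and 0 otherwise. *)
Definition ext (k : fieldType) (U : vectType k) : Type :=
  {ffun {set 'I_(\dim {:U})} -> k^o}.

HB.instance Definition _ (k : fieldType) (U : vectType k) :=
  Vector.on (ext U).

Section ExteriorAlgebra.
Variables (k : fieldType) (U : vectType k).
Let d := \dim {:U}.
Implicit Types (I J K L : {set 'I_d}) (x y z : ext U).

Definition inversions I J : nat :=
  #|[set p : 'I_d * 'I_d | [&& p.1 \in I, p.2 \in J & (p.2 < p.1)%N]]|.

Definition ext_one : ext U := [ffun I => (I == set0)%:R].

Definition ext_mul x y : ext U :=
  [ffun K => \sum_(I in powerset K)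
     (-1) ^+ inversions I (K :\: I) * (x I : k) * (y (K :\: I) : k)].

Lemma inversionsUl I J L : [disjoint I & J] ->
  inversions (I :|: J) L = (inversions I L + inversions J L)%N.
Proof.
move=> dIJ; rewrite /inversions -cardsUI.
rewrite [X in (_ + X)%N](_ : _ = 0%N) ?addn0; last first.
  apply/eqP; rewrite cards_eq0; apply/eqP/setP=> -[i j]; rewrite !inE /=.
  by case: (boolP (i \in I)) => //= /(disjointFr dIJ)->; rewrite andbF.
by apply: eq_card => -[i j]; rewrite !inE /= -andb_orl.
Qed.

Lemma inversionsUr I J L : [disjoint J & L] ->
  inversions I (J :|: L) = (inversions I J + inversions I L)%N.
Proof.
move=> dJL; rewrite /inversions -cardsUI.
rewrite [X in (_ + X)%N](_ : _ = 0%N) ?addn0; last first.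
  apply/eqP; rewrite cards_eq0; apply/eqP/setP=> -[i j]; rewrite !inE /=.
  case: (boolP (j \in J)) => //= [/(disjointFr dJL)->|]; rewrite ?andbF //.
by apply: eq_card => -[i j]; rewrite !inE /= -andb_orr -andb_orl.
Qed.

Lemma inversions0l J : inversions set0 J = 0%N.
Proof. by apply/eqP; rewrite cards_eq0; apply/eqP/setP=> p; rewrite !inE. Qed.

Lemma inversions0r I : inversions I set0 = 0%N.
Proof.
by apply/eqP; rewrite cards_eq0; apply/eqP/setP=> p; rewrite !inE andbF.
Qed.

Lemma ext_mulA : associative ext_mul.
Proof.
move=> x y z; apply/ffunP=> K; rewrite !ffunE; symmetry.
under eq_bigr do rewrite ffunE mulr_sumr mulr_suml.
under [RHS]eq_bigr do rewrite ffunE mulr_sumr.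
rewrite (exchange_big_dep (fun I => I \in powerset K)) /=; last first.
  move=> M I; rewrite !powersetE => sMK sIM; exact: subset_trans sIM sMK.
apply: eq_bigr => I; rewrite powersetE => sIK.
rewrite (reindex_onto (fun J => I :|: J) (fun M => M :\: I)) /=; last first.
  move=> M; rewrite !powersetE => /andP[_ sIM].
  apply/setP=> i; rewrite !inE.
  by case: (boolP (i \in I)) => // /(subsetP sIM)->.
apply: eq_big => [J|J].
  rewrite !powersetE subUset sIK subsetUl andbT subsetD.
  congr (_ && _); rewrite setDUl setDv set0U.
  by apply/eqP/idP=> [/setDidPl|/setDidPl].
rewrite !powersetE subsetUl andbT subUset sIK /= => /andP[sJK /eqP defJ].
have dIJ : [disjoint I & J].
  rewrite -setI_eq0 -defJ; apply/eqP/setP=> i; rewrite !inE.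
  by case: (i \in I).
have defKIJ : K :\: I :\: J = K :\: (I :|: J) by rewrite setDDl.
have defKI : K :\: I = J :|: (K :\: (I :|: J)).
  apply/setP=> i; rewrite !inE negb_or.
  case: (boolP (i \in J)) => [iJ|_] /=; last by rewrite andbT.
  by rewrite (subsetP sJK) // (disjointFl dIJ iJ).
have dJK : [disjoint J & K :\: (I :|: J)].
  rewrite -setI_eq0; apply/eqP/setP=> i; rewrite !inE negb_or.
  by case: (i \in J); rewrite ?andbF.
rewrite defJ defKIJ inversionsUl // [in RHS]defKI inversionsUr // !exprD.
set a := (-1) ^+ _; set b := (-1) ^+ _; set c := (-1) ^+ _.
rewrite -!mulrA [RHS]mulrCA; congr (_ * _).
by rewrite mulrCA; congr (_ * _); rewrite mulrCA.
Qed.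

Lemma ext_mul1l : left_id ext_one ext_mul.
Proof.
move=> x; apply/ffunP=> K; rewrite ffunE (bigD1 set0) ?powersetE ?sub0set //=.
rewrite big1 ?addr0 => [|I /andP[_ /negPf I0]]; last first.
  by rewrite ffunE I0 mulr0 mul0r.
by rewrite ffunE eqxx setD0 inversions0l expr0 !mul1r.
Qed.

Lemma ext_mul1r : right_id ext_one ext_mul.
Proof.
move=> x; apply/ffunP=> K; rewrite ffunE (bigD1 K) ?powersetE //=.
rewrite big1 ?addr0 => [|I /andP[]]; last first.
  rewrite powersetE ffunE setD_eq0 => sIK neIK.
  by rewrite [K \subset I](contraNF _ neIK) ?mulr0 // eqEsubset sIK.
by rewrite ffunE setDv eqxx inversions0r expr0 mul1r mulr1.
Qed.

Lemma ext_mulDl : left_distributive ext_mul +%R.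
Proof.
move=> x y z; apply/ffunP=> K; rewrite !ffunE -big_split /=.
by apply: eq_bigr => I _; rewrite ffunE mulrDr mulrDl.
Qed.

Lemma ext_mulDr : right_distributive ext_mul +%R.
Proof.
move=> x y z; apply/ffunP=> K; rewrite !ffunE -big_split /=.
by apply: eq_bigr => I _; rewrite ffunE mulrDr.
Qed.

Lemma ext_one_neq0 : ext_one != 0.
Proof.
by apply/eqP=> /ffunP/(_ set0); rewrite !ffunE eqxx; apply/eqP/oner_neq0.
Qed.

HB.instance Definition _ := GRing.Zmodule_isNzRing.Build (ext U)
  ext_mulA ext_mul1l ext_mul1r ext_mulDl ext_mulDr ext_one_neq0.

Lemma ext_scaleAl (a : k) x y : a *: (x * y) = (a *: x) * y.
Proof.
apply/ffunP=> K; rewrite !ffunE scaler_sumr; apply: eq_bigr => I _.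
by rewrite ffunE -!mulrA [RHS]mulrCA.
Qed.

HB.instance Definition _ := GRing.Lmodule_isLalgebra.Build k (ext U)
  ext_scaleAl.

Lemma ext_scaleAr (a : k) x y : a *: (x * y) = x * (a *: y).
Proof.
apply/ffunP=> K; rewrite !ffunE scaler_sumr; apply: eq_bigr => I _.
by rewrite ffunE [RHS]mulrCA.
Qed.

HB.instance Definition _ := GRing.Lalgebra_isAlgebra.Build k (ext U)
  ext_scaleAr.
HB.instance Definition _ := Algebra_isFalgebra.Build k (ext U).

End ExteriorAlgebra.

Section ExteriorFunctor.
Variables (k : fieldType) (U : vectType k).

Definition ext_inj_fun (u : U) : ext U :=
  [ffun I => \sum_(i | I == [set i]) coord (vbasis {:U}) i u].

Fact ext_inj_is_linear : linear ext_inj_fun.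
Proof.
move=> a u v; apply/ffunP=> I; rewrite !ffunE scaler_sumr -big_split /=.
by apply: eq_bigr => i _; rewrite linearP.
Qed.

HB.instance Definition _ :=
  GRing.isLinear.Build k U (ext U) _ ext_inj_fun ext_inj_is_linear.

Definition ext_inj : 'Hom(U, ext U) := linfun ext_inj_fun.

(* e_I is sent to the product of the f e_i (i in I) in increasing order. *)
Definition ext_map_fun (f : 'End(U)) (x : ext U) : ext U :=
  \sum_(I : {set 'I_(\dim {:U})})
    (x I : k) *: \prod_(i in I) ext_inj (f (vbasis {:U})`_i).

Fact ext_map_is_linear f : linear (ext_map_fun f).
Proof.
move=> a x y; rewrite /ext_map_fun scaler_sumr -big_split /=.
by apply: eq_bigr => I _; rewrite !ffunE scalerDl scalerA.
Qed.

HB.instance Definition _ f :=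
  GRing.isLinear.Build k (ext U) (ext U) _ (ext_map_fun f)
    (ext_map_is_linear f).

Definition ext_map (f : 'End(U)) : 'End(ext U) := linfun (ext_map_fun f).

Definition ext_wedge (u : U) : 'End(ext U) := amull (ext_inj u).

(* Since F |-> ext F preserves inclusions, the exterior powers and the exterior
   algebra of a subspace F of U are subspaces of ext U. *)
Definition ext_pow (F : {vspace U}) (i : nat) : {vspace ext U} :=
  ((ext_inj @: F) ^+ i)%VS.

Definition ext_sub (F : {vspace U}) : {vspace ext U} := agenv (ext_inj @: F).

End ExteriorFunctor.
Arguments ext_inj {k U}.

Lemma ext_inj_anticomm (k : fieldType) (U : vectType k) (u v : U) :
  ext_inj u * ext_inj v = - (ext_inj v * ext_inj u).
Proof.
apply/ffunP=> K; rewrite !lfunE /= !ffunE -sumrN.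
rewrite (reindex_onto (fun I => K :\: I) (fun I => K :\: I)) /=; last first.
  by move=> I; rewrite powersetE => sIK; rewrite setDDr setDv set0U (setIidPr sIK).
apply: eq_big => [I|I].
  rewrite !powersetE subsetDl setDDr setDv set0U /=.
  by apply/eqP/setIidPr.
case/andP=> _ /eqP defI; rewrite defI.
rewrite -!mulrA -mulrN [_ (K :\: I) * _]mulrC.
rewrite !ffunE.
have [c1|c1] := boolP (#|I| == 1)%N; last first.
  rewrite big1 ?mul0r ?oppr0 ?mulr0 //.
    by move=> i /eqP II; rewrite II cards1 in c1.
have [c2|c2] := boolP (#|K :\: I| == 1)%N; last first.
  rewrite [\sum_(i | K :\: I == [set i]) _]big1 ?mulr0 ?oppr0 ?mulr0 //.
    by move=> i /eqP II; rewrite II cards1 in c2.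
rewrite mulrN -mulNr; congr (_ * _).
case/cards1P: c1 => i defI'; case/cards1P: c2 => j defJ.
have nij : j != i.
  have : j \in K :\: I by rewrite defJ set11.
  by rewrite defI' !inE => /andP[].
have inv1 (a b : 'I_(\dim {:U})) : inversions [set a] [set b] = (b < a)%N.
  rewrite /inversions.
  have [ba|ba] := boolP (b < a)%N.
    apply/eqP/cards1P; exists (a, b); apply/setP=> -[a' b']; rewrite !inE /=.
    apply/and3P/eqP=> [[/eqP-> /eqP-> _]|[-> ->]] //.
  apply/eqP; rewrite cards_eq0; apply/eqP/setP=> -[a' b']; rewrite !inE /=.
  by apply/negP=> /and3P[/eqP-> /eqP->]; apply/negP.
rewrite defJ defI' !inv1.
case: (ltngtP i j) nij => [_ _|_ _|/val_inj->]; rewrite ?eqxx //= expr0 expr1 ?opprK //.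
Qed.

(* Tensor product of A and B, in coordinates with respect to the basis
   a_i (x) b_j, where a_i and b_j run through the bases vbasis {:A}, vbasis {:B}. *)
Definition tensor (k : fieldType) (A B : vectType k) : Type :=
  {ffun 'I_(\dim {:A}) * 'I_(\dim {:B}) -> k^o}.

HB.instance Definition _ (k : fieldType) (A B : vectType k) :=
  Vector.on (tensor A B).

Section Tensor.
Variables (k : fieldType) (A B : vectType k).

Definition tens (a : A) (b : B) : tensor A B :=
  [ffun p => coord (vbasis {:A}) p.1 a * coord (vbasis {:B}) p.2 b].

Definition tens_map_fun (f : 'End(A)) (g : 'End(B)) (x : tensor A B) :
    tensor A B :=
  \sum_p (x p : k) *: tens (f (vbasis {:A})`_p.1) (g (vbasis {:B})`_p.2).

Fact tens_map_is_linear f g : linear (tens_map_fun f g).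
Proof.
move=> a x y; rewrite /tens_map_fun scaler_sumr -big_split /=.
by apply: eq_bigr => p _; rewrite !ffunE scalerDl scalerA.
Qed.

HB.instance Definition _ f g :=
  GRing.isLinear.Build k (tensor A B) (tensor A B) _ (tens_map_fun f g)
    (tens_map_is_linear f g).

Definition tens_map f g : 'End(tensor A B) := linfun (tens_map_fun f g).

Definition tens_sub (E : {vspace A}) (F : {vspace B}) :
    {vspace tensor A B} :=
  <<[seq tens a b | a <- vbasis E, b <- vbasis F]>>%VS.

End Tensor.

Section InnerProducts.
Variable k : fieldType.

Definition std_inner n (u v : 'rV[k]_n) : k := \sum_(i < n) u 0 i * v 0 i.

Fact std_inner_is_bilinear n : bilinear_for *%R *%R (@std_inner n).
Proof.
split=> [u a v w|u a v w] /=; rewrite /std_inner mulr_sumr -big_split /=.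
  by apply: eq_bigr => i _; rewrite !mxE mulrDl mulrA.
by apply: eq_bigr => i _; rewrite !mxE mulrDr mulrCA.
Qed.

HB.instance Definition _ n := bilinear_isBilinear.Build k
  'rV[k]_n 'rV[k]_n k _ _ (@std_inner n) (@std_inner_is_bilinear n).

Fact std_inner_is_symmetric n (u v : 'rV[k]_n) :
  std_inner u v = (-1) ^+ false * idfun (std_inner v u).
Proof. by rewrite mul1r; apply: eq_bigr => i _; rewrite mulrC. Qed.

HB.instance Definition _ n := isHermitianSesquilinear.Build k 'rV[k]_n
  false idfun (@std_inner n) (@std_inner_is_symmetric n).

Variables (V : vectType k) (form : {symmetric V}).

Definition nondegenerate_on (F : {vspace V}) : bool :=
  (F :&: orthov form F == 0)%VS.

(* Meaningful when form is nondegenerate on F, so that V is the direct sum of F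
   and its orthogonal. *)
Definition orth_proj (F : {vspace V}) : 'End(V) :=
  daddv_pi F (orthov form F).

End InnerProducts.

Record signed_arrangement (k : fieldType) (V : vectType k) (n : nat) :=
  SignedArrangement {
    inner_product : {symmetric V};
    inner_nondegenerate : nondegenerate inner_product;
    vec : 'I_n -> V;
    positive : {set 'I_n}
  }.

(* Laurent polynomials are computed in the field algC(t), where t = q^(1/2);
   it contains Z[i, q^(1/2), q^(-1/2)] as a subring. For half-integers j and l,
   (-1)^j = i^(2j) and q^l = t^(2l). *)
Definition laurent : Type := {fraction {poly algC}}.
HB.instance Definition _ := GRing.Field.on laurent.

Definition sqrt_q : laurent := tofrac 'X.
Definition sqrt_m1 : laurent := tofrac ('i : algC)%:P.
Definition q_var : laurent := sqrt_q ^+ 2.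

Section Arrangement.
Variables (k : fieldType) (V : vectType k) (n : nat).
Variable A : signed_arrangement V n.
Implicit Types (S : {set 'I_n}) (r : 'I_n).

Local Notation nu := (vec A).
Local Notation form := (inner_product A).
Local Notation dot := (@std_inner k n : {symmetric 'rV[k]_n}).

Definition Hsp S : {vspace V} := (\bigcap_(s in S) orthov form <[nu s]>)%VS.

Definition Vsp S : {vspace V} := (\sum_(s in S) <[nu s]>)%VS.

Definition relations_map (w : 'rV[k]_n) : V := \sum_(i < n) w 0 i *: nu i.

Fact relations_map_is_linear : linear relations_map.
Proof.
move=> a u v; rewrite /relations_map scaler_sumr -big_split /=.
by apply: eq_bigr => i _; rewrite !mxE scalerDl scalerA.
Qed.

HB.instance Definition _ :=
  GRing.isLinear.Build k 'rV[k]_n V _ relations_map relations_map_is_linear.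

Definition coordinate r (w : 'rV[k]_n) : k^o := w 0 r.

Fact coordinate_is_linear r : linear (coordinate r).
Proof. by move=> a u v; rewrite /coordinate !mxE. Qed.

HB.instance Definition _ r :=
  GRing.isLinear.Build k 'rV[k]_n k^o _ (coordinate r)
    (coordinate_is_linear r).

Definition Wfull : {vspace 'rV[k]_n} := lker (linfun relations_map).

Definition Wsp S : {vspace 'rV[k]_n} :=
  (Wfull :&: \bigcap_(r | r \notin S) lker (linfun (coordinate r)))%VS.

Definition vec_dual r : 'rV[k]_n := orth_proj dot Wfull (delta_mx 0 r).

Definition tilde S : {set 'I_n} := (S :&: positive A) :|: (~: positive A :\: S).

(* The form is nondegenerate on exactly those subspaces onto which the
   definitions of vec_dual and edge project. *)
Definition projections_defined : Prop :=
  nondegenerate_on dot Wfull /\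
  forall S r, r \notin S ->
    if r \in positive A then
      nondegenerate_on form (Hsp (r |: tilde S)) /\
      (nu r \in Vsp (tilde S) -> nondegenerate_on dot (Wsp (r |: tilde S)))
    else
      nondegenerate_on dot (Wsp (tilde S :\ r)) /\
      (nu r \notin Vsp (tilde S :\ r) ->
         nondegenerate_on form (Hsp (tilde S :\ r))).

Definition framed_jones : laurent :=
  \sum_(S : {set 'I_n})
    sqrt_m1 ^ (#|S|%:Z *+ 2 - n%:Z) * sqrt_q ^ (#|S|%:Z *+ 2 - n%:Z)
    * (q_var + q_var^-1) ^+ (\dim (Hsp (tilde S)) + \dim (Wsp (tilde S))).

(* Every T_S is a subspace of \Lambda V (x) \Lambda k^n, and T = \bigoplus_S T_S
   is a subspace of the space cube of families indexed by S. *)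
Definition vertex : vectType k := tensor (ext V) (ext 'rV[k]_n).
Definition cube : vectType k := {ffun {set 'I_n} -> vertex}.

Definition Tsp S : {vspace vertex} :=
  tens_sub (ext_sub (Hsp (tilde S))) (ext_sub (Wsp (tilde S))).

(* For r \notin S, edge S r is an endomorphism of the ambient space whose
   restriction to T_S is \delta_(S, r); inclusions become identities. *)
Definition edge S r : 'End(vertex) :=
  if r \in positive A then
    tens_map (ext_map (orth_proj form (Hsp (r |: tilde S))))
      (if nu r \notin Vsp (tilde S) then \1%VF
       else ext_wedge (orth_proj dot (Wsp (r |: tilde S)) (vec_dual r)))
  else
    tens_map
      (if nu r \in Vsp (tilde S :\ r) then \1%VF
       else ext_wedge (orth_proj form (Hsp (tilde S :\ r)) (nu r)))
      (ext_map (orth_proj dot (Wsp (tilde S :\ r)))).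

Definition anticommuting_scalars (eps : {set 'I_n} -> 'I_n -> k) : Prop :=
  (forall S r, r \notin S -> eps S r != 0) /\
  (forall S r s, r \notin S -> s \notin S -> r != s ->
     {in Tsp S, forall x,
       eps (r |: S) s *: edge (r |: S) s (eps S r *: edge S r x) +
       eps (s |: S) r *: edge (s |: S) r (eps S s *: edge S s x) = 0}).

Section Homology.
Variable eps : {set 'I_n} -> 'I_n -> k.

Definition differential_fun (x : {ffun {set 'I_n} -> vertex}) : cube :=
  [ffun S : {set 'I_n} =>
     \sum_(r in S) eps (S :\ r) r *: edge (S :\ r) r (x (S :\ r))].

Fact differential_is_linear : linear differential_fun.
Proof.
move=> a x y; apply/ffunP=> S; rewrite !ffunE scaler_sumr -big_split /=.
apply: eq_bigr => r _.
by rewrite !ffunE linearP scalerDr !scalerA [a * _]mulrC.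
Qed.

HB.instance Definition _ :=
  GRing.isLinear.Build k cube cube _ differential_fun differential_is_linear.

Definition differential : 'End(cube) := linfun differential_fun.

Definition at_vertex_fun S (x : vertex) : cube :=
  [ffun S' : {set 'I_n} => if S' == S then x else 0].

Fact at_vertex_is_linear S : linear (at_vertex_fun S).
Proof.
move=> a x y; apply/ffunP=> S'; rewrite !ffunE.
by case: eqP => // _; rewrite scaler0 addr0.
Qed.

HB.instance Definition _ S :=
  GRing.isLinear.Build k vertex cube _ (at_vertex_fun S)
    (at_vertex_is_linear S).

(* Degrees are half-integers, and are represented by their doubles. *)
Definition hom_degree2 S : int := #|S|%:Z *+ 2 - n%:Z.

Definition q_degree2 S (a b : nat) : int :=
  (#|S|%:Z + (\dim (Hsp (tilde S)))%:Z + (\dim (Wsp (tilde S)))%:Z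
     - (a + b)%N%:Z *+ 2) *+ 2 - n%:Z.

Definition Tgraded (j2 l2 : int) : {vspace cube} :=
  (\sum_(S : {set 'I_n} | hom_degree2 S == j2)
   \sum_(a < (\dim (Hsp (tilde S))).+1)
   \sum_(b < (\dim (Wsp (tilde S))).+1 | q_degree2 S a b == l2)
     linfun (at_vertex_fun S) @:
       tens_sub (ext_pow (Hsp (tilde S)) a) (ext_pow (Wsp (tilde S)) b))%VS.

(* The quotient of cycles by boundaries, realized as a complement of the
   boundaries in the space of cycles. *)
Definition Hkh (j2 l2 : int) : {vspace cube} :=
  ((Tgraded j2 l2 :&: lker differential)
     :\: (differential @: Tgraded (j2 - 2) l2))%VS.

(* The sum over all bidegrees is \sum_(_ \in _) of fsbigop: it is the sum of the
   nonzero terms, which are finitely many. *)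
Definition graded_euler_char : laurent :=
  \sum_(d \in [set: int * int]%classic)
    sqrt_m1 ^ d.1 * (\dim (Hkh d.1 d.2))%:R * sqrt_q ^ d.2.

End Homology.
End Arrangement.

(* Main.v *)
From HB Require Import structures.
Require Import Defs.
From mathcomp Require Import classical_sets fsbigop.
From mathcomp Require Import all_boot all_order all_algebra all_field.
From mathcomp Require Import fraction sesquilinear zify.
Set Implicit Arguments.
Unset Strict Implicit.
Unset Printing Implicit Defensive.
Import GRing.Theory.
Local Open Scope ring_scope.

(** Two facts combine: the Euler characteristic of a bounded complex may be
computed on chains, and the chain groups of the cube have the dimensions that
the state sum counts.

For the first, the edge maps preserve the q-degree. Adding an index r to a set
S of vectors changes exactly one of dim H_S and dim W_S by one: H drops if
nu_r lies outside V_S ([dim_Hsp_setU1], where nondegeneracy of the inner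
product enters as V_S^{perp perp} = V_S), and W grows otherwise
([dim_Wsp_setU1]). In each of the four cases this change, the unit step of
|S| and the possible wedge by one vector balance out ([edge_Tbideg]). Hence
the differential D restricts to a map of homological degree one on each
q-degree; its square vanishes because the signed squares anticommute and the
characteristic is not 2 ([differential_sq_at_vertex]). Rank-nullity then gives
dim T^j = dim H^j + rk D_j + rk D_(j-1) ([dim_Hkh]), and the ranks telescope in
the alternating sum. With doubled degrees, (-1)^j is i^(2j), so consecutive
homological degrees differ by 2 and the cancellation reads i^(j2+2) = -i^(j2).

For the second, T_S has the basis e_I (x) e_J, where e_I and e_J are wedges of
basis vectors of H and W indexed by subsets. A dual family of functionals
([cube_basis_dual]) shows that all these vectors together are linearly
independent in the cube, so the dimension of a bidegree is the number of triples
(S, I, J) of that bidegree ([dim_Tgraded]). Summing the weights of the triples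
with S fixed, the sums over I and J are expanded binomials, and give
(q + q^-1)^(dim H + dim W) ([sum_subsets_qdim], [framed_jones_chains]). *)

(** * Exterior powers and their bases *)

Lemma linear_lfun (K : fieldType) (aT rT : vectType K) (f : aT -> rT) :
  linear f -> exists g : 'Hom(aT, rT), g =1 f.
Proof.
move=> f_lin.
pose L : {linear aT -> rT} :=
  HB.pack f (GRing.isLinear.Build K aT rT *:%R f f_lin).
by exists (linfun L) => x; rewrite lfunE.
Qed.

(** The sign comes from moving y_i past the factors that precede it in the
increasing product. Since c depends on i and J only, the same sign occurs for
every anticommuting family; this is what makes [ext_map] multiplicative. *)
Lemma mul_anticommuting_prod d (i : 'I_d) (J : {set 'I_d}) :
  exists c : nat, forall (R : nzRingType) (y : 'I_d -> R),
    (forall a b, y a * y b = - (y b * y a)) -> (forall a, y a * y a = 0) ->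
  y i * \prod_(j in J) y j =
  if i \in J then 0 else (-1) ^+ c * \prod_(j in i |: J) y j.
Proof.
have := index_enum_uniq 'I_d; have := mem_index_enum i.
move: (index_enum _) => r ir; case/splitPr: r / ir => s1 s2.
rewrite cat_uniq /= => /and4P[_ /norP[i1 _] i2 _].
exists (count [in J] s1) => R y anti sq0.
have move s : y i * (\prod_(j <- s | j \in J) y j) =
    (-1) ^+ count [in J] s * ((\prod_(j <- s | j \in J) y j) * y i).
  elim: s => [|j s IH]; first by rewrite !big_nil mulr1 !mul1r.
  rewrite !big_cons /=; case: (j \in J); last exact: IH.
  rewrite mulrA (anti i j) mulNr -[y j * y i * _]mulrA IH add1n exprS mulN1r.
  rewrite mulNr.
  by rewrite !mulrA (commr_sign (y j)).
rewrite !big_cat !big_cons /= mulrA move; case: ifP => iJ.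
  by rewrite -!mulrA [y i * (y i * _)]mulrA sq0 mul0r !mulr0.
rewrite setU11 -!mulrA.
have strip s : i \notin s ->
    \prod_(j <- s | j \in i |: J) y j = \prod_(j <- s | j \in J) y j.
  move=> is_; rewrite big_seq_cond [RHS]big_seq_cond; apply: eq_bigl => j.
  by rewrite !inE; case: eqP => // ->; rewrite (negPf is_).
by rewrite !strip.
Qed.

Section ExteriorBasis.
Variables (k : fieldType) (U : vectType k).
Hypothesis two_neq0 : 2%:R != 0 :> k.
Local Notation d := (\dim {:U}).
Implicit Types (u v : U) (x y : ext U).

Lemma ext_inj_sq u : ext_inj u * ext_inj u = 0.
Proof.
apply/eqP; have /eqP := ext_inj_anticomm u u.
rewrite -addr_eq0 -mulr2n -scaler_nat scaler_eq0 (negPf two_neq0) //.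
Qed.

Lemma mul_ext_inj_prod d' (f : 'I_d' -> U) i (J : {set 'I_d'}) :
  exists c : nat, 
  ext_inj (f i) * \prod_(j in J) ext_inj (f j) =
  if i \in J then 0 else (-1) ^+ c * \prod_(j in i |: J) ext_inj (f j).
Proof.
have [c E] := mul_anticommuting_prod i J; exists c.
apply: (E (ext U)) => [a b|a]; [exact: ext_inj_anticomm|exact: ext_inj_sq].
Qed.

Definition ext_delta (I : {set 'I_d}) : ext U := [ffun J => (J == I)%:R].

Lemma ext_sumE x : x = \sum_I (x I : k) *: ext_delta I.
Proof.
apply/ffunP=> J; rewrite sum_ffunE (bigD1 J) //= big1 ?addr0 => [|I nIJ].
  by rewrite !ffunE eqxx [_ *: _]mulr1.
by rewrite !ffunE eq_sym (negPf nIJ) scaler0.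
Qed.

Lemma ext_inj_basis (i : 'I_d) :
  ext_inj (vbasis {:U})`_i = ext_delta [set i].
Proof.
apply/ffunP=> J; rewrite lfunE /= !ffunE.
case: (eqVneq J [set i]) => [->|nJ].
  rewrite (big_pred1 i) => [|j]; last by rewrite (inj_eq set1_inj) eq_sym.
  by rewrite coord_free ?eqxx // (basis_free (vbasisP _)).
rewrite big1 // => j /eqP EJ; rewrite coord_free ?(basis_free (vbasisP _)) //.
by case: eqP => // ji; rewrite EJ ji eqxx in nJ.
Qed.

Lemma ext_deltaM (I J : {set 'I_d}) : [disjoint I & J] ->
  ext_delta I * ext_delta J = (-1) ^+ inversions I J *: ext_delta (I :|: J).
Proof.
move=> dIJ; apply/ffunP=> K; rewrite !ffunE.
have eqK (L : {set 'I_d}) : L \subset K ->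
   ((L == I) && (K :\: L == J)) = (L == I) && (K == I :|: J).
  move=> sLK; case: eqP => //= EL; subst L; apply/eqP/eqP=> [<-|->].
    by rewrite setUC -[LHS](setID K I) (setIidPr sLK) setUC.
  by rewrite setDUl setDv set0U; apply/setDidPl; rewrite disjoint_sym.
rewrite (eq_bigr (fun L => ((L == I) && (K == I :|: J))%:R *
                           (-1) ^+ inversions I J)) => [|L]; last first.
  rewrite powersetE => sLK; rewrite -(eqK L sLK) !ffunE -mulrA -natrM mulnb.
  case: andP => [[/eqP-> /eqP->]|_]; first by rewrite mulr1 mul1r.
  by rewrite mulr0 mul0r.
case: (K =P I :|: J) => [->|_]; last first.
  by rewrite big1 ?scaler0 // => L _; rewrite andbF mul0r.
rewrite (bigD1 I) ?powersetE ?subsetUl //= eqxx /= mul1r [_ *: _]mulr1.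
by rewrite big1 ?addr0 // => L /andP[_ /negPf->]; rewrite mul0r.
Qed.

(** Each new factor comes before all the later ones, so that no inversion, and
no sign, arises. *)
Lemma prod_ext_inj_sorted (s : seq 'I_d) : sorted ltn (map val s) ->
  \prod_(i <- s) ext_inj (vbasis {:U})`_i = ext_delta [set i in s].
Proof.
elim: s => [_|i s IH].
  rewrite big_nil (_ : [set _ in _] = set0); last first.
    by apply/setP=> a; rewrite !inE.
  by apply/ffunP=> J; rewrite !ffunE.
rewrite /= (path_sortedE ltn_trans) => /andP[/allP lti ss].
rewrite big_cons IH // ext_inj_basis ext_deltaM.
  rewrite (_ : inversions _ _ = 0%N) ?scale1r; last first.
    apply/eqP; rewrite cards_eq0; apply/eqP/setP=> -[a b]; rewrite !inE /=.
    apply/and3P=> [[/eqP-> bs]]; apply/negP; rewrite -leqNgt ltnW //.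
    by apply: lti; rewrite map_f.
  by congr ext_delta; apply/setP=> a; rewrite !inE.
rewrite disjoints1 inE; apply/negP=> /(map_f val)/lti.
by rewrite /= ltnn.
Qed.

Lemma prod_ext_inj_mono m (h : 'I_m -> 'I_d) (I : {set 'I_m}) :
  {mono h : i j / (i < j)%N} ->
  \prod_(i in I) ext_inj (vbasis {:U})`_(h i) = ext_delta (h @: I).
Proof.
move=> hmono; rewrite -big_filter.
rewrite -(big_map h xpredT (fun i => ext_inj (vbasis {:U})`_i)).
rewrite prod_ext_inj_sorted; last first.
  rewrite -map_comp sorted_map.
  rewrite (eq_sorted (e' := relpre val ltn)) => [|i j]; last exact: hmono.
  apply: sorted_filter; first by move=> a b c; apply: ltn_trans.
  rewrite -sorted_map -[index_enum _]enumT val_enum_ord.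
  exact: iota_ltn_sorted.
congr ext_delta; apply/setP=> j; rewrite inE; apply/mapP/imsetP=> -[i].
  by rewrite mem_filter => /andP[iI _] ->; exists i.
by move=> iI ->; exists i; rewrite // mem_filter iI mem_index_enum.
Qed.

Lemma prod_ext_inj_basis (I : {set 'I_d}) :
  \prod_(i in I) ext_inj (vbasis {:U})`_i = ext_delta I.
Proof. by rewrite (@prod_ext_inj_mono _ id) ?imset_id. Qed.

Section Functor.
Variable g : 'End(U).

Lemma ext_map_delta (I : {set 'I_d}) :
  ext_map g (ext_delta I) = \prod_(i in I) ext_inj (g (vbasis {:U})`_i).
Proof.
rewrite lfunE /= /ext_map_fun (bigD1 I) //= ffunE eqxx scale1r.
by rewrite [X in _ + X]big1 ?addr0 // => J /negPf nJ; rewrite ffunE nJ scale0r.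
Qed.

Lemma ext_map1 : ext_map g 1 = 1.
Proof.
rewrite -[X in ext_map g X]/(ext_delta set0).
by rewrite ext_map_delta big_set0.
Qed.

(** Both sides are linear in u and x, and on basis vectors the two products
reorder with the same sign. *)
Lemma ext_map_injM u x :
  ext_map g (ext_inj u * x) = ext_inj (g u) * ext_map g x.
Proof.
rewrite (coord_vbasis (memvf u)) !linear_sum !mulr_suml linear_sum.
apply: eq_bigr => i _; rewrite !linearZ /= -!scalerAl linearZ; congr (_ *: _).
rewrite (ext_sumE x) linear_sum !mulr_sumr linear_sum; apply: eq_bigr => J _.
rewrite linearZ /= -!scalerAr linearZ; congr (_ *: _).
have [c E] := mul_anticommuting_prod i J.
rewrite -{1}prod_ext_inj_basis ext_map_delta.
rewrite (E _ (fun i => ext_inj (vbasis {:U})`_i)); first last.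
- by move=> a; apply: ext_inj_sq.
- by move=> a b; apply: ext_inj_anticomm.
rewrite (E _ (fun i => ext_inj (g (vbasis {:U})`_i))); first last.
- by move=> a; apply: ext_inj_sq.
- by move=> a b; apply: ext_inj_anticomm.
case: ifP => _; first by rewrite linear0.
rewrite prod_ext_inj_basis -!(signr_odd _ c) !mulr_sign -ext_map_delta.
by case: ifP => // _; rewrite linearN.
Qed.

Lemma ext_map_prod (J : finType) (P : pred J) (u : J -> U) :
  ext_map g (\prod_(j | P j) ext_inj (u j)) = \prod_(j | P j) ext_inj (g (u j)).
Proof.
elim: (index_enum J) => [|j s IH]; first by rewrite !big_nil ext_map1.
by rewrite !big_cons; case: (P j); rewrite ?ext_map_injM IH.
Qed.

Lemma ext_map_pow (F F' : {vspace U}) a :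
  (forall u, u \in F -> g u \in F') ->
  (ext_map g @: ext_pow F a <= ext_pow F' a)%VS.
Proof.
move=> gF; apply/subvP=> _ /memv_imgP[x xF ->].
elim: a x xF => [|a IH] x.
  rewrite /ext_pow !expv0 => /vlineP[c ->].
  by rewrite linearZ /= ext_map1 memvZ ?memv_line.
rewrite memv_preim; apply: subvP x.
rewrite /ext_pow expvSl; apply/prodvP=> _ y /memv_imgP[u uF ->] yF.
rewrite -memv_preim expvSl ext_map_injM memv_mul ?memv_img ?gF //.
exact: IH.
Qed.

End Functor.

Lemma ext_wedge_pow (F F' : {vspace U}) a u : (F <= F')%VS -> u \in F' ->
  (ext_wedge u @: ext_pow F a <= ext_pow F' a.+1)%VS.
Proof.
move=> FF' uF'; apply/subvP=> _ /memv_imgP[x xF ->].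
rewrite /ext_wedge lfunE /= /ext_pow expvSl memv_mul ?memv_img //.
by apply: subvP x xF; apply: expvS; apply: limgS.
Qed.

Section Subspace.
Variable F : {vspace U}.
Local Notation m := (\dim F).

Definition ext_basis (I : {set 'I_m}) : ext U :=
  \prod_(i in I) ext_inj (vbasis F)`_i.

Lemma ext_basis_pow I : ext_basis I \in ext_pow F #|I|.
Proof.
rewrite /ext_basis /ext_pow -big_filter; case: big_enumP => e _ _ [_ <-].
elim: e => [|i s IH]; first by rewrite big_nil expv0 memv_line.
rewrite big_cons /= expvSl memv_mul // memv_img // vbasis_mem //.
by rewrite mem_nth ?size_tuple.
Qed.

(** A vector of F times e_J is a combination of the e_(j |: J) with j outside J, so
each step of the recursion defining the powers of F adds one element to the
index sets. *)
Lemma ext_powE a :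
  ext_pow F a = (\sum_(I : {set 'I_m} | #|I| == a) <[ext_basis I]>)%VS.
Proof.
apply/eqP; rewrite eqEsubv; apply/andP; split; last first.
  by apply/subv_sumP=> I /eqP <-; rewrite -memvE ext_basis_pow.
elim: a => [|a IH].
  rewrite /ext_pow expv0; apply: (sumv_sup set0); first by rewrite cards0.
  by rewrite /ext_basis big_set0.
rewrite /ext_pow expvSl; apply: subv_trans (prodvSr _ IH) _.
apply/prodvP=> _ y /memv_imgP[u uF ->] /memv_sumP[z zP ->].
rewrite mulr_sumr; apply: memv_suml => J /eqP cJ.
have /vlineP[c ->] := zP J (introT eqP cJ).
rewrite -scalerAr memvZ // (coord_vbasis uF) linear_sum mulr_suml.
apply: memv_suml => i _; rewrite linearZ -scalerAl memvZ //=.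
have [e ->] := mul_ext_inj_prod (fun i => (vbasis F)`_i) i J.
case: ifP => iJ; first exact: mem0v.
rewrite -signr_odd mulr_sign.
suff: \prod_(j in i |: J) ext_inj (vbasis F)`_j \in
      (\sum_(I : {set 'I_m} | #|I| == a.+1) <[ext_basis I]>)%VS.
  by case: ifP; rewrite ?memvN.
apply: (subvP (sumv_sup (i |: J) _ (subvv _))); last exact: memv_line.
by rewrite cardsU1 iJ cJ.
Qed.

Lemma ext_pow_gt_dim a : (m < a)%N -> ext_pow F a = 0%VS.
Proof.
move=> ma; rewrite ext_powE big_pred0 // => I; apply/negbTE.
by rewrite neq_ltn (leq_ltn_trans _ ma) // -[X in (_ <= X)%N]card_ord max_card.
Qed.

(** A linear map that sends the basis of F, in order, to the first vectors of the
basis of U sends e_I to a coordinate vector of ext U. Pulling back the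
coordinates of ext U along the induced algebra map gives the dual family. *)
Lemma ext_basis_dual : exists phi : {set 'I_m} -> 'Hom(ext U, k^o),
  forall I J, phi I (ext_basis J) = (I == J)%:R.
Proof.
have le_md : (m <= d)%N by apply/dimvS/subvf.
pose h := widen_ord le_md.
pose g0 (u : U) := \sum_(i < m) coord (vbasis F) i u *: (vbasis {:U})`_(h i).
have [g gE0] : exists g : 'End(U), g =1 g0.
  apply: linear_lfun => a u v; rewrite /g0 scaler_sumr -big_split.
  by apply: eq_bigr => i _; rewrite linearP scalerDl scalerA.
have gE (i : 'I_m) : g (vbasis F)`_i = (vbasis {:U})`_(h i).
  rewrite gE0 /g0 (bigD1 i) //= coord_free ?(basis_free (vbasisP _)) //.
  rewrite eqxx scale1r big1 ?addr0 // => j ji.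
  rewrite coord_free ?(basis_free (vbasisP _)) //.
  by rewrite eq_sym (negPf ji) scale0r.
have /fin_all_exists[e0 e0E] (I : {set 'I_m}) :
    exists f : 'Hom(ext U, k^o), forall x, f x = x (h @: I).
  by apply: linear_lfun => a x y; rewrite !ffunE.
exists (fun I => (e0 I \o ext_map g)%VF) => I J.
rewrite comp_lfunE e0E ext_map_prod.
under eq_bigr do rewrite gE.
rewrite prod_ext_inj_mono // ffunE (inj_eq (imset_inj _)) // => a b.
by move=> hab; apply: val_inj; exact: (congr1 val hab).
Qed.

End Subspace.
End ExteriorBasis.

(** * Dual families and tensor products *)

Section DualFamily.
Variables (k : fieldType) (vT : vectType k).

Lemma dim_sum_dual (X : finType) (f : X -> vT) (phi : X -> 'Hom(vT, k^o)) :
  (forall x y, phi x (f y) = (x == y)%:R) ->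
  forall P : pred X, \dim (\sum_(x | P x) <[f x]>)%VS = #|P|.
Proof.
move=> dual P.
have f0 x : f x != 0.
  by apply: contra_eq_neq (dual x x) => ->; rewrite linear0 eqxx eq_sym oner_eq0.
have /directvP/= -> : directv (\sum_(x | P x) <[f x]>)%VS.
  apply/directv_sum_independent => u uf sum0 x Px.
  have [c uc] : exists c : X -> k, forall y, P y -> u y = c y *: f y.
    suff: forall y, exists c : k, P y -> u y = c *: f y by apply: fin_all_exists.
    move=> y; case Py: (P y); last by exists 0.
    by have /vlineP[c ->] := uf y Py; exists c.
  have /eqP := congr1 (phi x) sum0; rewrite linear0 linear_sum (bigD1 x) //=.
  rewrite big1 ?addr0 => [|y /andP[Py yx]].
    by rewrite uc // linearZ /= dual eqxx /= [_ *: _]mulr1 => /eqP->; rewrite scale0r.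
  by rewrite uc // linearZ /= dual eq_sym (negPf yx) /= scaler0.
by rewrite -sum1_card; apply: eq_bigr => x _; rewrite dim_vline f0.
Qed.

End DualFamily.

Section TensorProducts.
Variables (k : fieldType) (A B : vectType k).
Implicit Types (a : A) (b : B) (E : {vspace A}) (F : {vspace B}).

Lemma tensZl c a b : tens (c *: a) b = c *: tens a b.
Proof. by apply/ffunP=> p; rewrite !ffunE linearZ -mulrA. Qed.

Lemma tensZr c a b : tens a (c *: b) = c *: tens a b.
Proof. by apply/ffunP=> p; rewrite !ffunE linearZ mulrCA. Qed.

Lemma tens0l b : tens (0 : A) b = 0.
Proof. by rewrite -(scale0r 0) tensZl scale0r. Qed.

Lemma tens0r a : tens a (0 : B) = 0.
Proof. by rewrite -(scale0r 0) tensZr scale0r. Qed.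

Lemma tens_suml I (r : seq I) (P : pred I) (a : I -> A) b :
  tens (\sum_(i <- r | P i) a i) b = \sum_(i <- r | P i) tens (a i) b.
Proof.
apply/ffunP=> p; rewrite sum_ffunE ffunE linear_sum mulr_suml.
by apply: eq_bigr => i _; rewrite ffunE.
Qed.

Lemma tens_sumr I (r : seq I) (P : pred I) a (b : I -> B) :
  tens a (\sum_(i <- r | P i) b i) = \sum_(i <- r | P i) tens a (b i).
Proof.
apply/ffunP=> p; rewrite sum_ffunE ffunE linear_sum mulr_sumr.
by apply: eq_bigr => i _; rewrite ffunE.
Qed.

Lemma tens_mapE f g a b : tens_map f g (tens a b) = tens (f a) (g b).
Proof.
rewrite lfunE /= /tens_map_fun [in RHS](coord_vbasis (memvf a)).
rewrite [in RHS](coord_vbasis (memvf b)) !linear_sum tens_suml.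
under [RHS]eq_bigr do rewrite tens_sumr.
rewrite pair_bigA; apply: eq_bigr => -[i j] _ /=.
by rewrite !linearZ /= tensZl tensZr scalerA ffunE.
Qed.

Lemma memv_tens a b E F : a \in E -> b \in F -> tens a b \in tens_sub E F.
Proof.
move=> aE bF; rewrite (coord_vbasis aE) (coord_vbasis bF) tens_suml.
apply: memv_suml => i _; rewrite tens_sumr; apply: memv_suml => j _.
rewrite tensZl tensZr !memvZ // memv_span //; apply: allpairs_f.
  by rewrite mem_nth ?size_tuple.
by rewrite mem_nth ?size_tuple.
Qed.

Lemma tens_subP E F (X : {vspace tensor A B}) :
  (forall a b, a \in E -> b \in F -> tens a b \in X) -> (tens_sub E F <= X)%VS.
Proof.
move=> sX; apply/span_subvP=> _ /allpairsP[[a b] [/= aE bF ->]].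
by apply: sX; apply: vbasis_mem.
Qed.

Lemma tens_subS E E' F F' : (E <= E')%VS -> (F <= F')%VS ->
  (tens_sub E F <= tens_sub E' F')%VS.
Proof.
move=> sE sF; apply: tens_subP => a b aE bF.
by rewrite memv_tens ?(subvP sE) ?(subvP sF).
Qed.

Lemma tens_map_sub f g E E' F F' : (f @: E <= E')%VS -> (g @: F <= F')%VS ->
  (tens_map f g @: tens_sub E F <= tens_sub E' F')%VS.
Proof.
move=> sE sF; apply/subvP=> _ /memv_imgP[x xEF ->].
rewrite memv_preim; apply: subvP x xEF; apply: tens_subP => a b aE bF.
rewrite -memv_preim tens_mapE memv_tens //.
  by rewrite (subvP sE) ?memv_img.
by rewrite (subvP sF) ?memv_img.
Qed.

(** Contracting with a pair of functionals turns dual families of A and of B into a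
dual family of the tensor product. *)
Lemma tens_contract (alpha : 'Hom(A, k^o)) (beta : 'Hom(B, k^o)) :
  exists gamma : 'Hom(tensor A B, k^o),
    forall a b, gamma (tens a b) = alpha a * beta b.
Proof.
pose gam (x : tensor A B) : k^o := \sum_i \sum_j (x (i, j) : k) *
  (alpha (vbasis {:A})`_i * beta (vbasis {:B})`_j).
have [gamma gammaE] : exists gamma : 'Hom(tensor A B, k^o), gamma =1 gam.
  apply: linear_lfun => c x y; rewrite /gam scaler_sumr -big_split.
  apply: eq_bigr => i _; rewrite scaler_sumr -big_split; apply: eq_bigr => j _.
  by rewrite !ffunE mulrDl -mulrA.
exists gamma => a b; rewrite gammaE /gam.
rewrite {2}(coord_vbasis (memvf a)) {2}(coord_vbasis (memvf b)) !linear_sum mulr_suml.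
apply: eq_bigr => i _; rewrite mulr_sumr; apply: eq_bigr => j _.
by rewrite ffunE /= !linearZ /= mulrACA.
Qed.

Lemma tens_sub_lines (I J : finType) (P : pred I) (Q : pred J)
    (a_ : I -> A) (b_ : J -> B) :
  tens_sub (\sum_(i | P i) <[a_ i]>) (\sum_(j | Q j) <[b_ j]>) =
  (\sum_(p : I * J | P p.1 && Q p.2) <[tens (a_ p.1) (b_ p.2)]>)%VS.
Proof.
apply/eqP; rewrite eqEsubv; apply/andP; split; last first.
  apply/subv_sumP=> -[i j] /= /andP[Pi Qj]; rewrite -memvE memv_tens //.
    by rewrite memvE (sumv_sup i).
  by rewrite memvE (sumv_sup j).
apply: tens_subP => _ _ /memv_sumP[u uP ->] /memv_sumP[v vQ ->].
rewrite tens_suml; apply: memv_suml => i Pi; rewrite tens_sumr.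
apply: memv_suml => j Qj.
have /vlineP[c ->] := uP i Pi; have /vlineP[e ->] := vQ j Qj.
by rewrite tensZl tensZr !memvZ // memvE (sumv_sup (i, j)) //= Pi.
Qed.

End TensorProducts.

(** * Dimensions of the spaces H and W *)

Section Orthogonality.
Variables (k : fieldType) (V : vectType k) (form : {symmetric V}).
Implicit Types (U X : {vspace V}).

Lemma orthov_add U X : orthov form (U + X) = (orthov form U :&: orthov form X)%VS.
Proof.
by apply/vspaceP=> v; rewrite memv_cap [LHS]orthovD.
Qed.

Lemma dim_cap_orthov X U :
  (\dim X <= \dim (X :&: orthov form U) + \dim U)%N.
Proof.
have cut (s : seq V) : (\dim X <= \dim (X :&: orthov form <<s>>) + size s)%N.
  elim: s => [|v s IH]; first by rewrite span_nil orthov0 capvf addn0.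
  rewrite span_cons addvC orthov_add capvA /= addnS -addSn.
  apply: leq_trans IH _; rewrite leq_add2r.
  have := leq_dim_orthov1 form v (X :&: orthov form <<s>>).
  by case: (\dim (X :&: _)).
by have := cut (vbasis U); rewrite size_tuple (span_basis (vbasisP U)).
Qed.

(** If u were orthogonal to the orthogonal of U without lying in U, then U and
U + <[u]> would have the same orthogonal X. Each vector cuts dimension by at
most one: this bounds \dim X below by the codimension of U, and, since a
complement of U + <[u]> cuts X down to the zero radical, above by the
codimension of U + <[u]>, which is smaller. *)
Lemma orthov_orthov U : nondegenerate form -> orthov form (orthov form U) = U.
Proof.
move=> nd; apply/eqP; rewrite eqEsubv; apply/andP; split; last first.
  by rewrite orthov_sym.
apply/subvP=> u uUU; apply: contraT => nuU.
have eqU : orthov form (U + <[u]>) = orthov form U.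
  rewrite orthov_add; apply/capv_idPl; rewrite -mem_orthov_sym //.
have := dim_cap_orthov (orthov form U) (U + <[u]>)^C.
rewrite -{2}eqU -orthov_add addv_complf (eqP nd) dimv0 add0n dimv_compl => le1.
have := dim_cap_orthov fullv U; rewrite capfv => le2.
have : (\dim U < \dim (U + <[u]>))%N.
  rewrite ltn_neqAle dimvS ?addvSl // andbT.
  apply: contraNneq nuU => /eqP; rewrite dimv_leqif_eq ?addvSl // => /eqP->.
  by rewrite memvE addvSr.
have := dimvS (subvf (U + <[u]>)); lia.
Qed.

End Orthogonality.

Section Dimensions.
Variables (k : fieldType) (V : vectType k) (n : nat).
Variable A : signed_arrangement V n.
Implicit Types (S : {set 'I_n}) (r : 'I_n).
Local Notation nu := (vec A).
Local Notation form := (inner_product A).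

Lemma Hsp_orthov S : Hsp A S = orthov form (Vsp A S).
Proof.
rewrite /Hsp /Vsp; elim/big_rec2: _ => [|s U X _ ->]; first by rewrite orthov0.
by rewrite orthov_add.
Qed.

Lemma Vsp_setU1 S r : Vsp A (r |: S) = (<[nu r]> + Vsp A S)%VS.
Proof.
have [rS|rS] := boolP (r \in S); last by rewrite /Vsp big_setU1.
rewrite (setUidPr _) ?sub1set //; apply/esym/addv_idPr.
by rewrite /Vsp (sumv_sup r).
Qed.

Lemma Hsp_setU1 S r : Hsp A (r |: S) = (Hsp A S :&: orthov form <[nu r]>)%VS.
Proof. by rewrite !Hsp_orthov Vsp_setU1 addvC orthov_add. Qed.

Lemma Hsp_setU1_dep S r : nu r \in Vsp A S -> Hsp A (r |: S) = Hsp A S.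
Proof.
by move=> rV; rewrite !Hsp_orthov Vsp_setU1 (addv_idPr _) // -memvE.
Qed.

(** The hyperplane orthogonal to nu_r contains H_S only if nu_r is orthogonal to
the orthogonal of V_S, hence lies in V_S. *)
Lemma dim_Hsp_setU1 S r : nu r \notin Vsp A S ->
  \dim (Hsp A S) = (\dim (Hsp A (r |: S))).+1.
Proof.
move=> rV; have nH : nu r \notin orthov form (Hsp A S).
  by rewrite Hsp_orthov orthov_orthov ?inner_nondegenerate.
rewrite Hsp_setU1 -(eq_dim_orthov1 nH) prednK // lt0n dimv_eq0.
by apply: contraNneq nH => ->; rewrite orthov0 memvf.
Qed.

Lemma mem_Wsp S w : reflect
  (relations_map A w = 0 /\ forall r, r \notin S -> w 0 r = 0) (w \in Wsp A S).
Proof.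
rewrite memv_cap memv_ker lfunE memvE /=; apply: (iffP andP) => -[/eqP-> wS]; split=> //.
  move=> r rS; move/subv_bigcapP/(_ r rS): wS.
  by rewrite -memvE memv_ker lfunE => /eqP.
by apply/subv_bigcapP=> r rS; rewrite -memvE memv_ker lfunE /= /coordinate wS.
Qed.

Lemma Wsp_sub S r : (Wsp A S <= Wsp A (r |: S))%VS.
Proof.
apply/subvP=> w /mem_Wsp[w0 wS]; apply/mem_Wsp; split=> // s.
by rewrite !inE negb_or => /andP[_ /wS].
Qed.

Lemma Wsp_setU1 S r : r \notin S ->
  Wsp A S = (Wsp A (r |: S) :&: lker (linfun (coordinate r)))%VS.
Proof.
move=> rS; apply/vspaceP=> w; rewrite memv_cap memv_ker lfunE /= /coordinate.
apply/mem_Wsp/andP=> [[w0 wS]|[/mem_Wsp[w0 wS] /eqP wr]].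
  split; last by rewrite wS.
  by apply/mem_Wsp; split=> // s; rewrite !inE negb_or => /andP[_ /wS].
split=> // s sS; have [->//|sr] := eqVneq s r.
by apply: wS; rewrite !inE negb_or sr.
Qed.

(** A relation with nonzero coefficient at r would express nu_r through the
vectors of S. *)
Lemma Wsp_setU1_indep S r : r \notin S -> nu r \notin Vsp A S ->
  Wsp A (r |: S) = Wsp A S.
Proof.
move=> rS rV; rewrite (Wsp_setU1 rS); apply/esym/capv_idPl/subvP=> w.
case/mem_Wsp=> w0 wS; rewrite memv_ker lfunE /= /coordinate.
apply: contraNT rV => wr; move: w0; rewrite /relations_map (bigD1 r) //=.
move/eqP; rewrite addr_eq0 => /eqP E.
rewrite -[nu r]scale1r -(mulVf wr) -scalerA E memvZ // memvN.
apply: memv_suml => s sr; have [sS|sS] := boolP (s \in S).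
  by rewrite memvZ // memvE /Vsp (sumv_sup s).
by rewrite wS ?scale0r ?mem0v // !inE negb_or sr.
Qed.

(** W_S is the kernel of the r-th coordinate on the larger space, and that
coordinate is nonzero on the relation expressing nu_r through S. *)
Lemma dim_Wsp_setU1 S r : r \notin S -> nu r \in Vsp A S ->
  \dim (Wsp A (r |: S)) = (\dim (Wsp A S)).+1.
Proof.
move=> rS rV; rewrite (Wsp_setU1 rS).
rewrite -(limg_ker_dim (linfun (coordinate r)) (Wsp A (r |: S))).
rewrite -[RHS]addn1.
congr (_ + _)%N; apply/eqP; rewrite eqn_leq; apply/andP; split.
  have := dimvS (subvf (linfun (coordinate r : _ -> k^o) @: Wsp A (r |: S))).
  by rewrite dimvf.
rewrite lt0n dimv_eq0 -lkerE.
have /memv_sumP[u uP Er] := rV.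
have [c uc] : exists c : 'I_n -> k, forall s, s \in S -> u s = c s *: nu s.
  suff: forall s, exists c : k, s \in S -> u s = c *: nu s.
    by apply: fin_all_exists.
  move=> s; case sS: (s \in S); last by exists 0.
  by have /vlineP[c ->] := uP s sS; exists c.
(* w is e_r minus the coefficients of nu_r over S. *)
pose w : 'rV[k]_n := \row_s ((s == r)%:R - (s \in S)%:R * c s).
apply/subvPn; exists w; last first.
  rewrite memv_ker lfunE /= /coordinate mxE eqxx (negPf rS) mul0r subr0.
  exact: oner_neq0.
apply/mem_Wsp; split; last first.
  move=> s; rewrite !inE negb_or mxE => /andP[/negPf-> /negPf->].
  by rewrite mul0r subr0.
rewrite /relations_map (eq_bigr (fun s =>
    (if s == r then nu s else 0) - (if s \in S then u s else 0))) => [|s _].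
  by rewrite sumrB -!big_mkcond big_pred1_eq Er subrr.
rewrite mxE scalerBl; congr (_ - _); first by case: eqP; rewrite ?scale1r ?scale0r.
by case: ifP => sS; rewrite ?mul1r ?mul0r ?scale0r ?uc.
Qed.

End Dimensions.

(** * The differential *)

Lemma memv_orth_proj (k : fieldType) (V : vectType k) (form : {symmetric V})
  (F : {vspace V}) v : orth_proj form F v \in F.
Proof. exact: memv_pi. Qed.

Section Cube.
Variables (k : fieldType) (V : vectType k) (n : nat).
Variable A : signed_arrangement V n.
Variable eps : {set 'I_n} -> 'I_n -> k.
Hypothesis two_neq0 : 2%:R != 0 :> k.
Implicit Types (S : {set 'I_n}) (r s : 'I_n).
Local Notation nu := (vec A).
Local Notation H S := (Hsp A (tilde A S)).
Local Notation W S := (Wsp A (tilde A S)).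

Lemma tilde_pos S r : r \in positive A -> r \notin S ->
  tilde A (r |: S) = r |: tilde A S /\ r \notin tilde A S.
Proof.
move=> rp rS; split; last by rewrite !inE rp (negPf rS).
apply/setP=> s; rewrite !inE; case: eqVneq => [->|] //=.
by rewrite rp.
Qed.

Lemma tilde_neg S r : r \notin positive A -> r \notin S ->
  tilde A (r |: S) = tilde A S :\ r /\ r \in tilde A S.
Proof.
move=> rp rS; split; last by rewrite !inE rp (negPf rS).
apply/setP=> s; rewrite !inE; case: eqVneq => [->|] //=.
by rewrite (negPf rp).
Qed.

Definition Tbideg S a b : {vspace vertex V n} :=
  tens_sub (ext_pow (H S) a) (ext_pow (W S) b).

Lemma Tbideg_sub S a b : (Tbideg S a b <= Tsp A S)%VS.
Proof. by apply: tens_subS; apply: subX_agenv. Qed.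

(** In the four cases of the definition of the edge maps the quantity
#|S| + dim H + dim W - 2 (a + b) is preserved: either H drops or W drops while
nothing is wedged, or W grows or H grows while one vector is wedged. *)
Lemma edge_Tbideg S r a b : r \notin S -> exists a' b',
  q_degree2 A (r |: S) a' b' = q_degree2 A S a b /\
  (edge A S r @: Tbideg S a b <= Tbideg (r |: S) a' b')%VS.
Proof.
move=> rS; rewrite /edge /Tbideg /q_degree2 cardsU1 rS.
have [rp|rp] := boolP (r \in positive A).
  have [-> rt] := tilde_pos rp rS.
  have [rV|rV] := boolP (nu r \in Vsp A (tilde A S)); [exists a, b.+1|exists a, b].
    split; first by rewrite Hsp_setU1_dep // dim_Wsp_setU1 //; lia.
    apply: tens_map_sub; first by apply: ext_map_pow => // u _; apply: memv_orth_proj.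
    by apply: ext_wedge_pow; rewrite ?Wsp_sub ?memv_orth_proj.
  split; first by rewrite (dim_Hsp_setU1 rV) Wsp_setU1_indep //; lia.
  apply: tens_map_sub; first by apply: ext_map_pow => // u _; apply: memv_orth_proj.
  by rewrite lim1g Wsp_setU1_indep.
have [-> rt] := tilde_neg rp rS.
(* For negative r the set shrinks from r |: t to t, so the dimension lemmas are
   used at t. *)
move: (setD1K rt) (setD11 r (tilde A S)); set t := tilde A S :\ r => <- /negbT rnt.
have [rV|rV] := boolP (nu r \in Vsp A t); [exists a, b|exists a.+1, b].
  split; first by rewrite Hsp_setU1_dep // dim_Wsp_setU1 //; lia.
  apply: tens_map_sub; first by rewrite lim1g Hsp_setU1_dep.
  by apply: ext_map_pow => // u _; apply: memv_orth_proj.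
split; first by rewrite (dim_Hsp_setU1 rV) Wsp_setU1_indep //; lia.
apply: tens_map_sub; last by apply: ext_map_pow => // u _; apply: memv_orth_proj.
by apply: ext_wedge_pow; rewrite ?memv_orth_proj // Hsp_setU1 capvSl.
Qed.

(** If H or W drops along an edge, the top exterior power is sent to a power beyond
the dimension of the target. Such powers are not among the summands of
[Tgraded], but they vanish. *)
Lemma Tbideg_Tgraded S a b :
  (linfun (at_vertex_fun S) @: Tbideg S a b <=
     Tgraded A (hom_degree2 S) (q_degree2 A S a b))%VS.
Proof.
have [aH|aH] := leqP a (\dim (H S)); last first.
  suff -> : Tbideg S a b = 0%VS by rewrite limg0 sub0v.
  apply/eqP; rewrite -subv0; apply: tens_subP => u v.
  by rewrite (ext_pow_gt_dim two_neq0 aH) memv0 => /eqP-> _; rewrite tens0l mem0v.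
have [bW|bW] := leqP b (\dim (W S)); last first.
  suff -> : Tbideg S a b = 0%VS by rewrite limg0 sub0v.
  apply/eqP; rewrite -subv0; apply: tens_subP => u v _.
  by rewrite (ext_pow_gt_dim two_neq0 bW) memv0 => /eqP->; rewrite tens0r mem0v.
rewrite /Tgraded; apply: (sumv_sup S) => //.
apply: (sumv_sup (Ordinal (aH : (a < _.+1)%N))) => //.
exact: (sumv_sup (Ordinal (bW : (b < _.+1)%N))).
Qed.

Lemma Tgraded_ind j l (X : {vspace cube V n}) :
  (forall S a b x, hom_degree2 S = j -> q_degree2 A S a b = l ->
     x \in Tbideg S a b -> at_vertex_fun S x \in X) ->
  (Tgraded A j l <= X)%VS.
Proof.
move=> sX; apply/subv_sumP=> S /eqP Sj; apply/subv_sumP=> a _.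
apply/subv_sumP=> b /eqP Sl; apply/subvP=> _ /memv_imgP[x xT ->].
by rewrite lfunE; apply: sX Sj Sl xT.
Qed.

Lemma differential_at_vertex S x :
  differential A eps (at_vertex_fun S x) =
  \sum_(r | r \notin S) at_vertex_fun (r |: S) (eps S r *: edge A S r x).
Proof.
rewrite lfunE; apply/ffunP=> S'; rewrite sum_ffunE ffunE.
rewrite big_mkcond [RHS]big_mkcond; apply: eq_bigr => r _; rewrite !ffunE.
case: (eqVneq S' (r |: S)) => [->|nS'].
  rewrite setU11; have [rS|rS] := boolP (r \in S); last by rewrite setU1K // eqxx.
  case: eqP => [E|]; last by rewrite linear0 scaler0.
  by have := setD11 r (r |: S); rewrite E rS.
rewrite if_same; case: ifP => // rS'; case: eqP => [E|].
  by rewrite -E setD1K ?eqxx in nS'.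
by rewrite linear0 scaler0.
Qed.

Lemma differential_Tgraded j l :
  (differential A eps @: Tgraded A j l <= Tgraded A (j + 2) l)%VS.
Proof.
apply/subvP=> _ /memv_imgP[y yT ->]; rewrite memv_preim; apply: subvP y yT.
apply: Tgraded_ind => S a b x Sj Sl xT.
rewrite -memv_preim differential_at_vertex; apply: memv_suml => r rS.
have [a' [b' [Sl' sub]]] := edge_Tbideg a b rS.
rewrite linearZ memvZ // -Sl -Sl'.
have -> : j + 2 = hom_degree2 (r |: S) by rewrite -Sj /hom_degree2 cardsU1 rS; lia.
apply: (subvP (Tbideg_Tgraded (r |: S) a' b')).
have := memv_img (linfun (at_vertex_fun (r |: S))) (subvP sub _ (memv_img _ xT)).
by rewrite lfunE.
Qed.

Hypothesis eps_ok : anticommuting_scalars A eps.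

(** The composite is a sum over ordered pairs (r, s) of distinct indices outside S;
exchanging r and s changes the sign of each term, so the sum is its own
opposite. *)
Lemma differential_sq_at_vertex S x : x \in Tsp A S ->
  differential A eps (differential A eps (at_vertex_fun S x)) = 0.
Proof.
move=> xT; rewrite differential_at_vertex linear_sum /=.
under eq_bigr do rewrite differential_at_vertex.
pose G r s : cube V n := at_vertex_fun (s |: (r |: S))
  (eps (r |: S) s *: edge A (r |: S) s (eps S r *: edge A S r x)).
have GC r s : r \notin S -> s \notin S -> r != s -> G r s = - G s r.
  move=> rS sS rs; apply/eqP; rewrite -addr_eq0 /G setUCA -linearD.
  by rewrite (eps_ok.2 S r s rS sS rs x xT) linear0.
pose Q r s := (r \notin S) && (s \notin r |: S).
have QC r s : Q r s = [&& r \notin S, s \notin S & r != s].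
  rewrite /Q !inE negb_or eq_sym [RHS]andbCA andbC -!andbA.
  by case: (r \in S); rewrite ?andbF ?andbT //= andbC.
set T := LHS; have T_sum : T = \sum_r \sum_(s | Q r s) G r s.
  rewrite /T big_mkcond; apply: eq_bigr => r _; rewrite /Q.
  by case: ifP => //= _; rewrite big_pred0.
have TN : T = - T.
  rewrite {1}T_sum (exchange_big_dep predT) //= T_sum -sumrN.
  apply: eq_bigr => r _; rewrite -sumrN; apply: eq_big => s.
    by rewrite !QC eq_sym; case: (r \in S); case: (s \in S).
  by rewrite QC => /and3P[sS rS sr]; apply: GC.
apply/eqP; have /eqP := TN; rewrite -addr_eq0 -mulr2n -scaler_nat scaler_eq0.
by rewrite (negPf two_neq0).
Qed.

Lemma differential_sq j l :
  (differential A eps @: Tgraded A j l <= lker (differential A eps))%VS.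
Proof.
apply/subvP=> _ /memv_imgP[y yT ->]; rewrite memv_preim; apply: subvP y yT.
apply: Tgraded_ind => S a b x _ _ xT; rewrite -memv_preim memv_ker.
by rewrite differential_sq_at_vertex ?(subvP (Tbideg_sub S a b)).
Qed.

(** The boundaries lie among the cycles of the same bidegree, so this is
rank-nullity for the outgoing differential. *)
Lemma dim_Hkh j l :
  (\dim (Hkh A eps j l) + \dim (differential A eps @: Tgraded A j l)
     + \dim (differential A eps @: Tgraded A (j - 2) l))%N
  = \dim (Tgraded A j l).
Proof.
set D := differential A eps; set T := Tgraded A.
have im : (D @: T (j - 2) l <= T j l :&: lker D)%VS.
  rewrite subv_cap differential_sq andbT.
  by have := differential_Tgraded (j - 2) l; rewrite subrK.
rewrite -(limg_ker_dim D (T j l)) addnAC; congr (_ + _)%N.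
rewrite -(dimv_cap_compl (T j l :&: lker D)%VS (D @: T (j - 2) l)%VS) addnC.
by rewrite (capv_idPr im).
Qed.

End Cube.

(** * A basis of the cube complex *)

Section Basis.
Variables (k : fieldType) (V : vectType k) (n : nat).
Variable A : signed_arrangement V n.
Hypothesis two_neq0 : 2%:R != 0 :> k.
Implicit Types (S : {set 'I_n}).
Local Notation H S := (Hsp A (tilde A S)).
Local Notation W S := (Wsp A (tilde A S)).

Definition cube_index : finType :=
  {S : {set 'I_n} & ({set 'I_(\dim (H S))} * {set 'I_(\dim (W S))})%type}.

Definition cube_basis (x : cube_index) : cube V n :=
  at_vertex_fun (tag x)
    (tens (ext_basis (tagged x).1) (ext_basis (tagged x).2)).

Definition bidegree2 (x : cube_index) : int * int :=
  (hom_degree2 (tag x), q_degree2 A (tag x) #|(tagged x).1| #|(tagged x).2|).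

(** Evaluation at the vertex S separates the vertices, and contraction with the dual
families of H and W separates the basis vectors at S. *)
Lemma cube_basis_dual : exists phi : cube_index -> 'Hom(cube V n, k^o),
  forall x y, phi x (cube_basis y) = (x == y)%:R.
Proof.
suff /fin_all_exists : forall x, exists f : 'Hom(cube V n, k^o),
  forall y, f (cube_basis y) = (x == y)%:R by [].
move=> [S [I J]].
have [phi phiE] := ext_basis_dual two_neq0 (H S).
have [psi psiE] := ext_basis_dual two_neq0 (W S).
have [gam gamE] := tens_contract (phi I) (psi J).
have [ev evE] : exists ev : 'Hom(cube V n, vertex V n), ev =1 (fun y => y S).
  by apply: linear_lfun => a u v; rewrite !ffunE.
exists (gam \o ev)%VF => -[S' [I' J']]; rewrite comp_lfunE evE ffunE /=.
have [ES|nS] := eqVneq S S'; last first.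
  by rewrite linear0; case: eqP => // /(congr1 tag)/= E; rewrite E eqxx in nS.
by subst S'; rewrite gamE phiE psiE eq_Tagged /= -natrM mulnb.
Qed.

Lemma Tgraded_basis j l :
  Tgraded A j l = (\sum_(x | bidegree2 x == (j, l)) <[cube_basis x]>)%VS.
Proof.
apply/eqP; rewrite eqEsubv; apply/andP; split; last first.
  apply/subv_sumP=> x /eqP[<- <-]; rewrite -memvE.
  apply: (subvP (Tbideg_Tgraded A two_neq0 (tag x) _ _)).
  rewrite /cube_basis -[at_vertex_fun _ _](lfunE (at_vertex_fun (tag x))).
  by rewrite memv_img // memv_tens ?ext_basis_pow.
apply: Tgraded_ind => S a b x Sj Sl.
rewrite /Tbideg !(ext_powE two_neq0) tens_sub_lines => /memv_sumP[u uP ->].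
rewrite linear_sum.
apply: memv_suml => p pab; have /vlineP[c ->] := uP p pab.
rewrite linearZ memvZ // memvE.
rewrite (sumv_sup (Tagged (fun S => _ * _)%type p : cube_index)) //=.
by case/andP: pab => /eqP Ea /eqP Eb; rewrite /bidegree2 /= Ea Eb Sj Sl.
Qed.

Lemma dim_Tgraded j l :
  \dim (Tgraded A j l) = #|[pred x | bidegree2 x == (j, l)]|.
Proof.
have [phi dual] := cube_basis_dual.
by rewrite Tgraded_basis (dim_sum_dual dual).
Qed.

End Basis.

(** * Euler characteristic and state sum *)

Section LaurentSums.

Lemma sqrt_q_neq0 : sqrt_q != 0.
Proof. by rewrite tofrac_eq0 polyX_eq0. Qed.

Lemma sqrt_m1_sq : sqrt_m1 ^+ 2 = -1.
Proof. by rewrite -rmorphXn -polyC_exp Num.Theory.sqrCi !rmorphN1. Qed.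

Lemma sqrt_m1_neq0 : sqrt_m1 != 0.
Proof. by rewrite -sqrf_eq0 sqrt_m1_sq oppr_eq0 oner_eq0. Qed.

(** The expansion of a product of h equal binomials over subsets, where an element
of I selects t^-2 and an element outside I selects t^2. *)
Lemma sum_subsets_qdim (R : fieldType) (t : R) h : t != 0 ->
  \sum_(I : {set 'I_h}) t ^ (h%:Z *+ 2 - #|I|%:Z *+ 4) =
  (t ^+ 2 + (t ^+ 2)^-1) ^+ h.
Proof.
move=> t0; rewrite addrC -[h in RHS]card_ord -prodr_const bigA_distr.
apply: eq_bigr => I _; rewrite (bigID [in I]) /=.
rewrite (eq_bigr (fun=> (t ^+ 2)^-1)) => [|i ->//].
rewrite [X in _ = _ * X](eq_bigr (fun=> t ^+ 2)) => [|i /negPf->//].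
rewrite !prodr_const.
have -> : #|[pred i : 'I_h | i \notin I]| = #|~: I|.
  by apply: eq_card => i; rewrite !inE.
have pow a b : t ^ ((a + b)%N%:Z *+ 2 - a%:Z *+ 4) =
    (t ^+ 2)^-1 ^+ a * (t ^+ 2) ^+ b.
  rewrite -exprVn -!exprM exprVn exprnN [t ^+ (2 * b)]exprnP -expfzDr //.
  by congr (t ^ _); lia.
by rewrite -pow cardsC card_ord.
Qed.

Lemma fsum_seq (R : nmodType) (T : choiceType) (r : seq T) (F : T -> R) :
  uniq r -> (forall d, d \notin r -> F d = 0) ->
  \sum_(d \in [set: T]%classic) F d = \sum_(d <- r) F d.
Proof.
move=> ur F0; rewrite [RHS]fsbig_seq //; apply/esym.
apply: (fsbig_widen [set` r]%classic [set: T]%classic F) => // d [_ /negP].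
exact: F0.
Qed.

End LaurentSums.

Section Euler.
Variables (k : fieldType) (V : vectType k) (n : nat).
Variable A : signed_arrangement V n.
Variable eps : {set 'I_n} -> 'I_n -> k.
Hypothesis two_neq0 : 2%:R != 0 :> k.
Hypothesis eps_ok : anticommuting_scalars A eps.

Definition weight (d : int * int) : laurent := sqrt_m1 ^ d.1 * sqrt_q ^ d.2.

Lemma weight_shift j l : weight (j + 2, l) = - weight (j, l).
Proof.
rewrite /weight /= expfzDr ?sqrt_m1_neq0 // -[_ ^ 2]exprnP sqrt_m1_sq.
by rewrite mulrN1 mulNr.
Qed.

Local Notation D := (differential A eps).
Local Notation T d := (Tgraded A d.1 d.2).
Local Notation bideg := (@bidegree2 k V n A).

(** Rank-nullity turns each term into a difference of three; in the last two,
the rank of the differential leaving d is counted once with the weight of d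
and once with the weight of the shifted bidegree, which is its opposite. The
supports lie in the list r of bidegrees of basis vectors and its shift. *)
Lemma graded_euler_char_chains :
  graded_euler_char A eps = \sum_x weight (bideg x).
Proof.
pose r := undup (codom bideg).
pose shift (d : int * int) : int * int := (d.1 + 2, d.2).
pose rank (d : int * int) := \dim (D @: T d).
have T0 d : d \notin r -> \dim (T d) = 0%N.
  rewrite mem_undup dim_Tgraded // => nd; apply: eq_card0 => x; rewrite !inE.
  by apply: contraNF nd => /eqP; case: d => d1 d2 /= <-; apply: codom_f.
have rank0 d : d \notin r -> rank d = 0%N.
  move=> nd; apply/eqP; rewrite -leqn0 -(T0 d nd).
  by rewrite -(limg_ker_dim D (T d)) leq_addl.
have shiftK : cancel shift (fun d => (d.1 - 2, d.2)).
  by case=> j l; rewrite /= addrK.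
have subK d : shift (d.1 - 2, d.2) = d by case: d => j l; rewrite /shift subrK.
pose r' := undup (r ++ map shift r).
have in_r d : d \notin r' -> d \notin r.
  by apply: contraNN => dr; rewrite mem_undup mem_cat dr.
have in_sr d : d \notin map shift r -> rank (d.1 - 2, d.2) = 0%N.
  move=> nd; apply: rank0; apply: contraNN nd => /(map_f shift).
  by rewrite subK.
have r'_sr d : d \notin r' -> d \notin map shift r.
  by apply: contraNN => dr; rewrite mem_undup mem_cat dr orbT.
have dimE d : (\dim (Hkh A eps d.1 d.2))%:R =
    (\dim (T d))%:R - (rank d)%:R - (rank (d.1 - 2, d.2))%:R :> laurent.
  by rewrite -(dim_Hkh two_neq0 eps_ok) -addnA -addrA -opprD -natrD natrD addrK.
pose F1 d := weight d * (\dim (T d))%:R.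
pose F2 d := weight d * (rank d)%:R.
pose F3 d := weight d * (rank (d.1 - 2, d.2))%:R.
(* Each sum over all bidegrees is taken over a list containing its support: the
   union of both supports while splitting, then r or its shift. *)
rewrite /graded_euler_char (fsum_seq (undup_uniq (r ++ map shift r))); last first.
  move=> d /in_r nd; suff -> : \dim (Hkh A eps d.1 d.2) = 0%N by rewrite mulr0 mul0r.
  by apply/eqP; rewrite -leqn0 -(T0 d nd) -(dim_Hkh two_neq0 eps_ok) -addnA leq_addr.
rewrite (eq_bigr (fun d => F1 d - F2 d - F3 d)) => [|d _]; last first.
  by rewrite dimE mulrAC -!mulrBr.
rewrite !sumrB -!(fsum_seq (undup_uniq _)); first last.
- by move=> d /in_r nd; rewrite /F1 T0 ?mulr0.
- by move=> d /in_r nd; rewrite /F2 rank0 ?mulr0.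
- by move=> d /r'_sr nd; rewrite /F3 in_sr ?mulr0.
rewrite (fsum_seq (undup_uniq (codom bideg))); last first.
  by move=> d nd; rewrite /F1 T0 ?mulr0.
rewrite (fsum_seq (r := map shift r) (F := F3)); first last.
- by move=> d nd; rewrite /F3 in_sr ?mulr0.
- by rewrite (map_inj_uniq (can_inj shiftK)) undup_uniq.
rewrite (fsum_seq (r := r) (F := F2)) ?undup_uniq //; last first.
  by move=> d nd; rewrite /F2 rank0 ?mulr0.
rewrite big_map -addrA -opprD -big_split [X in _ - X]big1 ?subr0 => [|d _]; last first.
  by rewrite /F2 /F3 /= addrK weight_shift -!surjective_pairing mulNr subrr.
have F1E d : F1 d = \sum_x (if bideg x == d then weight d else 0).
  rewrite /F1 dim_Tgraded // -big_mkcond sumr_const mulr_natr.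
  by congr (_ *+ _); apply: eq_card => x; rewrite !inE -surjective_pairing.
rewrite (eq_bigr _ (fun d _ => F1E d)) exchange_big; apply: eq_bigr => x _.
rewrite -big_mkcond (eq_bigl (pred1 (bideg x))) => [|d]; last by rewrite /= eq_sym.
by rewrite -big_filter filter_pred1_uniq ?undup_uniq ?mem_undup ?codom_f ?big_seq1.
Qed.

Lemma framed_jones_chains : framed_jones A = \sum_x weight (bideg x).
Proof.
transitivity (\sum_S
  \sum_(p : {set 'I_(\dim (Hsp A (tilde A S)))} *
             {set 'I_(\dim (Wsp A (tilde A S)))})
    weight (hom_degree2 S, q_degree2 A S #|p.1| #|p.2|)); last first.
  by rewrite sig_big_dep.
apply: eq_bigr => S _; set h := \dim _; set w := \dim (Wsp _ _).
rewrite -(pair_bigA _ (fun (I : {set 'I_h}) (J : {set 'I_w}) =>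
  weight (hom_degree2 S, q_degree2 A S #|I| #|J|))) /=.
rewrite exprD /q_var -!sum_subsets_qdim ?sqrt_q_neq0 //.
rewrite mulr_suml mulr_sumr; apply: eq_bigr => I _.
rewrite !mulr_sumr; apply: eq_bigr => J _.
rewrite /weight /hom_degree2 /q_degree2 -!mulrA; congr (_ * _).
rewrite -!expfzDr ?sqrt_q_neq0 //=; congr (_ ^ _); rewrite -/h -/w; lia.
Qed.

End Euler.

Theorem proposition3p5 (k : fieldType) (char_k : [pchar k] =i pred0)
    (V : vectType k) (n : nat) (A : signed_arrangement V n)
    (A_proj : projections_defined A)
    (eps : {set 'I_n} -> 'I_n -> k) (eps_ok : anticommuting_scalars A eps) :
  graded_euler_char A eps = framed_jones A.
Proof.
have two_neq0 : 2%:R != 0 :> k.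
  by move/pcharf0P: char_k => ->.
by rewrite (graded_euler_char_chains two_neq0 eps_ok) framed_jones_chains.
Qed.
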